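(* Let $n\ge1$. Consider, for $(\mathbf x,\mathbf X,\mathbf z)\in\mathbb R^n\times\mathbb R^{n\times n}\times\mathbb R^n$, the system (P): there exist $\mathbf g,\mathbf h\in\mathbb R^n$ such that $\mathbf h\le\mathbf x\le\mathbf g$ (componentwise), $$\begin{pmatrix}\sum_{i=1}^nz_i&-\mathbf g^\top\\-\mathbf g&\mathbf X\end{pmatrix}\in\mathcal S_+^{n+1}\quad\text{and}\quad\begin{pmatrix}\sum_{i=1}^n(1-z_i)&\mathbf h^\top\\\mathbf h&\mathbf X\end{pmatrix}\in\mathcal S_+^{n+1}.$$ Then (P) holds for every $(\mathbf x,\mathbf X,\mathbf z)\in\bar{\mathcal X}$, where $$\bar{\mathcal X}=\{(\mathbf x,\mathbf X,\mathbf z)\in\mathbb R^n\times\mathbb R^{n\times n}\times\{0,1\}^n:\ \mathbf X\succeq\mathbf x\mathbf x^\top,\ x_iz_i\ge0,\ x_i(1-z_i)\le0,\ i=1,\dots,n\}.$$ Moreover, for $(\mathbf x,\mathbf X,\mathbf z)\in\mathbb R^n\times\mathbb R^{n\times n}\times\mathbb R^n$ with $\mathbf X\succeq\mathbf x\mathbf x^\top$, (P) holds if and only if $$\begin{pmatrix}\sum_{i=1}^n z_i&-\mathbf x^\top\\-\mathbf x&\mathbf X\end{pmatrix}\in\mathcal C_+^{n+1}\quad\text{and}\quad\begin{pmatrix}\sum_{i=1}^n(1-z_i)&\mathbf x^\top\\\mathbf x&\mathbf X\end{pmatrix}\in\mathcal C_+^{n+1}.$$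
   Context: $\mathcal S_+^m$ is the cone of symmetric positive semidefinite $m\times m$ real matrices. $\mathcal C_+^m=\{\mathbf Y\in\mathbb R^{m\times m}:\mathbf Y=\mathbf Y^\top,\ \mathbf v^\top\mathbf Y\mathbf v\ge0\ \forall\mathbf v\in\mathbb R_+^m\}$ is the cone of copositive matrices. $\mathbf X\succeq\mathbf x\mathbf x^\top$ means $\mathbf X-\mathbf x\mathbf x^\top\in\mathcal S_+^n$. *)

(* Defs.v *)
From HB Require Import structures.
From mathcomp Require Import all_boot all_order all_algebra.
From mathcomp Require Import classical_sets reals.
Set Implicit Arguments.
Unset Strict Implicit.
Unset Printing Implicit Defensive.
Import Order.TTheory GRing.Theory Num.Theory.
Local Open Scope classical_set_scope.
Local Open Scope ring_scope.

(* The 1 x 1 matrix v^T Y v is identified with its entry. *)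
Definition quad_form (R : realType) (m : nat) (Y : 'M[R]_m) (v : 'cV[R]_m) : R :=
  (v^T *m Y *m v) 0 0.

Definition psd_cone (R : realType) (m : nat) : set 'M[R]_m :=
  [set Y | Y = Y^T /\ forall v : 'cV[R]_m, 0 <= quad_form Y v].

Definition copositive_cone (R : realType) (m : nat) : set 'M[R]_m :=
  [set Y | Y = Y^T /\
     forall v : 'cV[R]_m, (forall i, 0 <= v i 0) -> 0 <= quad_form Y v].

Definition bordered (R : realType) (n : nat) (t : R) (u : 'cV[R]_n)
    (X : 'M[R]_n) : 'M[R]_(1 + n) :=
  block_mx t%:M u^T u X.

Definition sysP (R : realType) (n : nat) (x : 'cV[R]_n) (X : 'M[R]_n)
    (z : 'cV[R]_n) : Prop :=
  exists g h : 'cV[R]_n,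
    [/\ forall i, h i 0 <= x i 0 <= g i 0,
        psd_cone (bordered (\sum_(i < n) z i 0) (- g) X) &
        psd_cone (bordered (\sum_(i < n) (1 - z i 0)) h X)].

Definition Xbar (R : realType) (n : nat) :
    set ('cV[R]_n * 'M[R]_n * 'cV[R]_n) :=
  [set p : 'cV[R]_n * 'M[R]_n * 'cV[R]_n | let: (x, X, z) := p in
     [/\ forall i, z i 0 = 0 \/ z i 0 = 1,
         psd_cone (X - x *m x^T),
         forall i, 0 <= x i 0 * z i 0 &
         forall i, x i 0 * (1 - z i 0) <= 0]].

(* Main.v *)
(** Up to the symmetry [x -> - x], one needs [g >= x] with
    [bordered T (- g) X] positive semidefinite.  Minimise
    [q v = v^T X v - 2 x^T v] over the nonnegative orthant and put [g = X v] at
    a minimiser [v].  The optimality conditions are [X v >= x] and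
    [v^T X v = x^T v]; copositivity at [(1, v)] then gives [v^T X v <= T],
    and [T t^2 - 2 t g^T w + w^T X w >= (t v - w)^T X (t v - w) >= 0].
    Since [X] dominates [x x^T], the vector [x] is orthogonal to the isotropic
    vectors of [X], so [q] has a stationary point on every coordinate subspace;
    by convexity the minimum over a face of the orthant is reached either at
    such a point or on a smaller face. *)
Require Import Defs.
From mathcomp Require Import all_boot all_order all_algebra.
From mathcomp Require Import ring lra.
From mathcomp Require Import classical_sets reals.
Import Order.TTheory GRing.Theory Num.Theory.
Local Open Scope ring_scope.

(** * Inner products and quadratic forms *)

Definition dot {R : realType} {n : nat} (u v : 'cV[R]_n) : R := (u^T *m v) 0 0.

Section Dot.
Context {R : realType} {n : nat}.
Implicit Types (u v w : 'cV[R]_n) (X : 'M[R]_n) (a : R).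

Lemma dotE u v : dot u v = \sum_i u i 0 * v i 0.
Proof. by rewrite /dot mxE; apply: eq_bigr => i _; rewrite mxE. Qed.

Lemma dotC u v : dot u v = dot v u.
Proof. by rewrite !dotE; apply: eq_bigr => i _; rewrite mulrC. Qed.

Lemma dotDr u v w : dot u (v + w) = dot u v + dot u w.
Proof. by rewrite /dot mulmxDr mxE. Qed.

Lemma dotZr a u v : dot u (a *: v) = a * dot u v.
Proof. by rewrite /dot -scalemxAr mxE. Qed.

Lemma dotNr u v : dot u (- v) = - dot u v.
Proof. by rewrite /dot mulmxN mxE. Qed.

Lemma dotDl u v w : dot (v + w) u = dot v u + dot w u.
Proof. by rewrite dotC dotDr !(dotC u). Qed.

Lemma dotZl a u v : dot (a *: v) u = a * dot v u.
Proof. by rewrite dotC dotZr dotC. Qed.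

Lemma dotNl u v : dot (- v) u = - dot v u.
Proof. by rewrite dotC dotNr dotC. Qed.

Lemma dot0r u : dot u 0 = 0.
Proof. by rewrite -(scale0r u) dotZr mul0r. Qed.

Lemma dot_delta u i : dot (delta_mx i 0) u = u i 0.
Proof.
rewrite dotE (bigD1 i) //= big1 ?addr0 => [|j nji]; first by rewrite mxE !eqxx mul1r.
by rewrite mxE (negPf nji) mul0r.
Qed.

Lemma dot_mul X u v : dot u (X *m v) = dot (X^T *m u) v.
Proof. by rewrite /dot trmx_mul trmxK mulmxA. Qed.

Lemma quad_formE X v : quad_form X v = dot v (X *m v).
Proof. by rewrite /quad_form /dot mulmxA. Qed.

Lemma le_dot u v w : (forall i, 0 <= w i 0) -> (forall i, u i 0 <= v i 0) ->
  dot u w <= dot v w.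
Proof. by move=> w0 uv; rewrite !dotE; apply: ler_sum => i _; apply: ler_wpM2r. Qed.

Lemma quad_formD {X} u v a : X = X^T ->
  quad_form X (u + a *: v) =
  quad_form X u + 2 * a * dot v (X *m u) + a ^+ 2 * quad_form X v.
Proof.
move=> sX; rewrite !quad_formE mulmxDr -scalemxAr !(dotDl, dotDr, dotZl, dotZr).
have -> : dot u (X *m v) = dot v (X *m u) by rewrite dot_mul -sX dotC.
ring.
Qed.

End Dot.

(** * Bordered matrices and domination of a rank-one matrix *)

Section Bordered.
Context {R : realType} {n : nat}.
Implicit Types (u v : 'cV[R]_n) (X : 'M[R]_n).

Lemma quad_form_bordered t u X (v : 'cV[R]_(1 + n)) :
  let s := v 0 0 in let w := dsubmx v in
  quad_form (bordered t u X) v = t * s ^+ 2 + 2 * s * dot u w + quad_form X w.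
Proof.
move=> s w; have -> : v = col_mx s%:M w.
  rewrite -[LHS]vsubmxK; congr col_mx.
  by rewrite [usubmx v]mx11_scalar mxE lshift0.
rewrite !quad_formE {1}/dot /bordered mul_block_col tr_col_mx mul_row_col.
rewrite tr_scalar_mx !mul_scalar_mx mul_mx_scalar mulmxDr -scalemxAr scalerDr.
have addE (A B : 'M[R]_1) : (A + B) 0 0 = A 0 0 + B 0 0 by rewrite mxE.
have scaleE a (A : 'M[R]_1) : (a *: A) 0 0 = a * A 0 0 by rewrite mxE.
rewrite !(addE, scaleE) [s%:M 0 0]mxE eqxx mulr1n -!/(dot _ _) (dotC w u).
ring.
Qed.

Lemma bordered_sym t u X : X = X^T -> bordered t u X = (bordered t u X)^T.
Proof. by move=> sX; rewrite /bordered tr_block_mx tr_scalar_mx trmxK -sX. Qed.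

Lemma psd_dominates {X u} : psd_cone (X - u *m u^T) ->
  X = X^T /\ forall v, dot u v ^+ 2 <= quad_form X v.
Proof.
move=> [sX pX]; split.
  by move: sX; rewrite linearB /= trmx_mul trmxK => /addIr.
move=> v; have := pX v; rewrite !quad_formE mulmxDl mulNmx dotDr dotNr subr_ge0.
by rewrite /dot -mulmxA [u^T *m v]mx11_scalar mul_mx_scalar -scalemxAr mxE
  -!/(dot _ _) dotC expr2 mxE eqxx mulr1n.
Qed.

End Bordered.

(** * Minimising a convex quadratic over the nonnegative orthant *)

Definition objective {R : realType} {n : nat} (X : 'M[R]_n) (x v : 'cV[R]_n) : R :=
  quad_form X v - 2 * dot x v.

Definition in_face {R : realType} {n : nat} (S : {set 'I_n}) (v : 'cV[R]_n) : Prop :=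
  (forall i, 0 <= v i 0) /\ (forall i, i \notin S -> v i 0 = 0).

Section NonnegativeMinimisation.
Context {R : realType} {n : nat} {X : 'M[R]_n} {x : 'cV[R]_n}.
Hypothesis X_dom : psd_cone (X - x *m x^T).
Implicit Types (u v w d : 'cV[R]_n) (S : {set 'I_n}).

Let X_sym : X = X^T := (psd_dominates X_dom).1.
Let X_ge v : dot x v ^+ 2 <= quad_form X v := (psd_dominates X_dom).2 v.
Let X_ge0 v : 0 <= quad_form X v := le_trans (sqr_ge0 _) (X_ge v).

Lemma objective_line v d (s : R) :
  objective X x (v + s *: d) =
  objective X x v + 2 * s * (dot d (X *m v - x)) + s ^+ 2 * quad_form X d.
Proof.
rewrite /objective quad_formD // !dotDr dotZr dotNr (dotC d x).
ring.
Qed.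

(** With [D] the projection onto the coordinates in [S], the task is to solve [D X D r = D x]. A
    solution exists because [D x] is orthogonal to the kernel of [D X D]: for [k] in it, the square
    of [x^T D k] is at most [k^T D X D k = 0]. *)
Lemma coordinate_stationary S : exists2 u : 'cV[R]_n,
  forall i, i \notin S -> u i 0 = 0 &
  forall w, (forall i, i \notin S -> w i 0 = 0) -> dot w (X *m u - x) = 0.
Proof.
pose D : 'M[R]_n := diag_mx (\row_i (i \in S)%:R).
have DE (w : 'cV[R]_n) i : (D *m w) i 0 = (i \in S)%:R * w i 0.
  by rewrite mul_diag_mx !mxE.
have DT : D^T = D by rewrite tr_diag_mx.
have : ((D *m x)^T <= D *m X *m D)%MS.
  rewrite submxE; apply/eqP/matrixP => i j; rewrite mxE [RHS]mxE.
  (* The columns of [K] span this kernel; row-space inclusion is tested by multiplying with [K]. *)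
  set K := cokermx _; have DK : D *m X *m D *m K = 0 := mulmx_coker _.
  clearbody K.
  have K0 : D *m (X *m (D *m col j K)) = 0.
    by rewrite colE !mulmxA DK mul0mx.
  have : dot x (D *m col j K) ^+ 2 <= 0.
    by rewrite (le_trans (X_ge _)) // quad_formE -{1}DT -dot_mul K0 dot0r.
  rewrite real_exprn_even_le0 ?num_real //= dot_mul DT dotE => /eqP dxk; rewrite -[RHS]dxk.
  by apply: eq_bigr => k _; rewrite ord1 !mxE.
case/submxP => r /(congr1 trmx); rewrite trmxK => rP.
exists (D *m r^T) => [i /negPf iS|w wS]; first by rewrite DE iS mul0r.
have Dw : D *m w = w.
  apply/matrixP => i j; rewrite ord1 DE.
  by have [_|/wS ->] := boolP (i \in S); rewrite ?mul1r ?mulr0.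
rewrite -Dw -{1}DT -dot_mul mulmxBr rP !trmx_mul DT -X_sym !mulmxA.
by rewrite subrr dot0r.
Qed.

(** Induction on the size of [S]. If the stationary point [u] leaves the orthant, each point of the
    face slides towards [u] onto a smaller face without raising the objective, so the best of the
    smaller minimisers wins. *)
Lemma face_minimiser S : exists2 v : 'cV[R]_n, in_face S v &
  forall w, in_face S w -> objective X x v <= objective X x w.
Proof.
have [m] := ubnP #|S|; elim: m S => // m IHm S; rewrite ltnS => Sm.
have [u uS ust] := coordinate_stationary S.
(* Stationarity of [u] makes the slope at [w] minus the curvature, so the change is nonpositive for
   [s] in [0, 1]. *)
have obju w (s : R) : in_face S w ->
    objective X x (w + s *: (u - w)) <= objective X x w +
      (s ^+ 2 - 2 * s) * quad_form X (u - w).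
  move=> [_ wS].
  have /ust st : forall i, i \notin S -> (u - w) i 0 = 0.
    by move=> i iS; rewrite !mxE uS // wS // subrr.
  have slope : dot (u - w) (X *m w - x) = - quad_form X (u - w).
    by rewrite quad_formE mulmxBr; move: st; rewrite !(dotDr, dotNr); lra.
  by rewrite objective_line slope; lra.
have [u0|/forallPn[i0 ui0]] := boolP [forall i, 0 <= u i 0].
  exists u => [|w wS]; first by split=> // i; apply/forallP: i.
  have := obju w 1 wS; have := X_ge0 (u - w).
  by rewrite scale1r [w + _]addrC subrK; lra.
have neg_in i : ~~ (0 <= u i 0) -> i \in S.
  by apply: contraR => /uS ->.
have /fin_all_exists[V VP] i : exists v, i \in S -> in_face (S :\ i) v /\
    forall w, in_face (S :\ i) w -> objective X x v <= objective X x w.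
  have [iS|iS] := boolP (i \in S); last by exists 0.
  have [|v v1 v2] := IHm (S :\ i); last by exists v.
  by rewrite (leq_trans _ Sm) // [leqRHS](cardsD1 i) iS.
have face_sub i v : in_face (S :\ i) v -> in_face S v.
  by move=> [v0 vS]; split=> // j jS; apply: vS; rewrite in_setD1 (negPf jS) andbF.
case: (arg_minP (fun i => objective X x (V i)) (neg_in _ ui0)) => i iS imin.
exists (V i) => [|w wS]; first by have [/face_sub] := VP i iS.
(* The segment from [w] to [u] leaves the orthant at the smallest ratio. *)
pose ratio j := w j 0 / (w j 0 - u j 0).
case: (@arg_minP _ _ _ i0 (fun j => ~~ (0 <= u j 0)) ratio ui0) => j uj jmin.
have [w0 wS0] := wS.
have ratioP k : ~~ (0 <= u k 0) -> 0 < w k 0 - u k 0 /\ 0 <= ratio k <= 1.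
  rewrite -ltNge => uk; have wk := w0 k.
  have den : 0 < w k 0 - u k 0 by lra.
  split=> //; rewrite /ratio divr_ge0 ?(ltW den) //=.
  by rewrite ler_pdivrMr //; lra.
have [denj ratioj] := ratioP j uj; set s := ratio j in ratioj jmin.
have wsS : in_face (S :\ j) (w + s *: (u - w)).
  split=> k; last first.
    rewrite in_setD1 negb_and negbK => /orP[/eqP->|kS].
      by rewrite !mxE /s /ratio; field; rewrite gt_eqF.
    by rewrite !mxE uS // wS0 //; ring.
  (* Where [u] is nonnegative this is a convex combination; elsewhere [s] is at most [ratio k]. *)
  rewrite !mxE; have wk := w0 k; have [uk|uk] := boolP (0 <= u k 0); first nra.
  have [denk _] := ratioP k uk.
  by have := jmin k uk; rewrite /ratio ler_pdivlMr //; lra.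
have jS := neg_in j uj.
rewrite (le_trans (imin j jS)) // (le_trans ((VP j jS).2 _ wsS)) //.
by rewrite (le_trans (obju w s wS)) // gerDl mulr_le0_ge0 //; nra.
Qed.

Lemma orthant_kkt : exists v : 'cV[R]_n, [/\ forall i, 0 <= v i 0,
  forall i, x i 0 <= (X *m v) i 0 & quad_form X v = dot x v].
Proof.
have [v [v0 _] vmin] := face_minimiser [set: 'I_n]; exists v.
(* First-order optimality of [v] on the convex orthant. *)
have variation w : (forall i, 0 <= w i 0) -> 0 <= dot (w - v) (X *m v - x).
  move=> w0; set d := w - v.
  have line (s : R) : 0 <= s <= 1 ->
      0 <= 2 * s * dot d (X *m v - x) + s ^+ 2 * quad_form X d.
    move=> s01; have := vmin (v + s *: d); rewrite objective_line -addrA lerDl.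
    apply; split=> i; last by rewrite inE.
    by rewrite !mxE; have := v0 i; have := w0 i; nra.
  rewrite leNgt; apply/negP; set c := dot _ _ in line * => c0.
  have q0 := X_ge0 d; set q := quad_form X d in line q0.
  have den : 0 < q - c by lra.
  (* The exact minimiser of the parabola, [- c / q], is undefined at [q = 0]; adding [- c] to the
     denominator keeps the step in [0, 1] and the value negative. *)
  have := line (- c / (q - c)).
  rewrite divr_ge0 ?ler_pdivrMr //; try lra.
  have -> : 2 * (- c / (q - c)) * c + (- c / (q - c)) ^+ 2 * q =
     c ^+ 2 * (2 * c - q) / (q - c) ^+ 2.
    by field; rewrite gt_eqF.
  have : c ^+ 2 * (2 * c - q) / (q - c) ^+ 2 < 0.
    rewrite pmulr_llt0 ?invr_gt0 ?exprn_gt0 // pmulr_rlt0; first lra.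
    by rewrite exprn_even_gt0 //= lt_eqF.
  by rewrite ltNge => /negP h /(_ _)/h; apply; lra.
split=> // [i|].
  have := variation (v + delta_mx i 0); rewrite [v + _ - v]addrC addKr dot_delta !mxE subr_ge0.
  by apply=> j; rewrite !mxE addr_ge0.
(* Testing with [2 v] and [0] gives both signs, hence complementarity. *)
have := variation 0; have := variation (v + v); rewrite addrK sub0r dotNl.
rewrite dotDr dotNr -quad_formE (dotC v x) => h1 h2.
have : 0 <= quad_form X v - dot x v by apply: h1 => i; rewrite mxE addr_ge0.
have : 0 <= - (quad_form X v - dot x v) by apply: h2 => i; rewrite mxE.
lra.
Qed.

(** * Passing between semidefinite and copositive bordered matrices *)

Lemma psd_bordered (t : R) (g : 'cV[R]_n) :
  (forall (s : R) w, 0 <= t * s ^+ 2 - 2 * s * dot g w + quad_form X w) ->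
  psd_cone (bordered t (- g) X).
Proof.
move=> H; split=> [|v]; first exact: bordered_sym.
by rewrite quad_form_bordered dotNl mulrN.
Qed.

Lemma copositive_psd_bordered (t : R) : copositive_cone (bordered t (- x) X) ->
  exists2 g : 'cV[R]_n, forall i, x i 0 <= g i 0 & psd_cone (bordered t (- g) X).
Proof.
move=> [_ cop]; have [v [v0 xXv Xv]] := orthant_kkt.
exists (X *m v) => //; apply: psd_bordered => s w.
have tXv : quad_form X v <= t.
  have := cop (col_mx 1%:M v); rewrite quad_form_bordered col_mxKd dotNl -Xv.
  have -> : col_mx 1%:M v 0 0 = 1 :> R.
    by rewrite -(lshift0 n 0) col_mxEu mxE eqxx.
  move=> h; suff : 0 <= t * 1 ^+ 2 + 2 * 1 * - quad_form X v + quad_form X v by lra.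
  by apply: h => i; rewrite mxE; case: splitP => j _; rewrite ?ord1 ?mxE.
have := X_ge0 (w + (- s) *: v).
rewrite quad_formD // dot_mul -X_sym (dotC _ w) sqrrN.
by have := sqr_ge0 s; nra.
Qed.

(** For [t = 0] take [g = 0]; for [1 <= t] take [g = x], since the form then dominates the square of
    [s - x^T w]. *)
Lemma psd_bordered_01 (t : R) : (t = 0 /\ forall i, x i 0 <= 0) \/ 1 <= t ->
  exists2 g : 'cV[R]_n, forall i, x i 0 <= g i 0 & psd_cone (bordered t (- g) X).
Proof.
case=> [[-> x0]|t1].
  exists 0 => [i|]; first by rewrite mxE.
  apply: psd_bordered => s w; rewrite dotC dot0r.
  by have := X_ge0 w; lra.
exists x => //; apply: psd_bordered => s w.
have := X_ge w; have := sqr_ge0 (s - dot x w); have := sqr_ge0 s; nra.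
Qed.

End NonnegativeMinimisation.

(** On nonnegative vectors, lowering [g] to [x] can only increase the cross term. *)
Lemma psd_copositive_bordered {R : realType} {n : nat} {X : 'M[R]_n}
    {t : R} {x g : 'cV[R]_n} : (forall i, x i 0 <= g i 0) ->
  psd_cone (bordered t (- g) X) -> copositive_cone (bordered t (- x) X).
Proof.
move=> xg [sB pB]; split=> [|v v0].
  apply: bordered_sym.
  by move: sB => /(congr1 drsubmx); rewrite /bordered tr_block_mx !block_mxKdr.
apply: le_trans (pB v) _; rewrite !quad_form_bordered !dotNl.
have le : dot x (dsubmx v) <= dot g (dsubmx v).
  by apply: le_dot => // i; rewrite mxE.
have := v0 0; nra.
Qed.

Lemma psd_dominates_opp {R : realType} {n : nat} {X : 'M[R]_n} {x : 'cV[R]_n} :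
  psd_cone (X - x *m x^T) -> psd_cone (X - (- x) *m (- x)^T).
Proof. by rewrite linearN /= mulNmx mulmxN opprK. Qed.

Lemma sum_binary {R : realType} {n : nat} (z : 'I_n -> R) :
  (forall i, z i = 0 \/ z i = 1) ->
  (\sum_i z i = 0 /\ forall i, z i = 0) \/ 1 <= \sum_i z i.
Proof.
move=> z01; have z_ge0 i : 0 <= z i by case: (z01 i) => ->.
have [/forallP z0|/forallPn[i zi]] := boolP [forall i, z i == 0].
  by left; split=> [|i]; [rewrite big1 // => i _|]; apply/eqP.
right; rewrite (bigD1 i) //=; case: (z01 i) zi => ->; rewrite ?eqxx // => _.
by rewrite lerDl sumr_ge0.
Qed.

Lemma sysP_of_bounds {R : realType} {n : nat} (x : 'cV[R]_n) (X : 'M[R]_n) (z : 'cV[R]_n) :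
  (exists2 g : 'cV[R]_n, forall i, x i 0 <= g i 0 &
     psd_cone (bordered (\sum_(i < n) z i 0) (- g) X)) ->
  (exists2 g : 'cV[R]_n, forall i, (- x) i 0 <= g i 0 &
     psd_cone (bordered (\sum_(i < n) (1 - z i 0)) (- g) X)) ->
  sysP x X z.
Proof.
move=> [g xg gP] [h xh hP]; exists g, (- h); split=> // i.
by rewrite xg andbT mxE lerNl; have := xh i; rewrite mxE.
Qed.

Theorem proposition8 (R : realType) (n : nat) (n_ge1 : (1 <= n)%N) :
  (forall (x : 'cV[R]_n) (X : 'M[R]_n) (z : 'cV[R]_n),
      Xbar (x, X, z) -> sysP x X z) /\
  (forall (x : 'cV[R]_n) (X : 'M[R]_n) (z : 'cV[R]_n),
      psd_cone (X - x *m x^T) ->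
      (sysP x X z <->
       copositive_cone (bordered (\sum_(i < n) z i 0) (- x) X) /\
       copositive_cone (bordered (\sum_(i < n) (1 - z i 0)) x X))).
Proof.
split=> x X z.
  move=> [z01 X_dom xz xz1]; apply: sysP_of_bounds.
    apply: psd_bordered_01 => //.
    (* A zero sum forces all [z i = 0], hence [x <= 0]; below, a zero sum of [1 - z i] forces
       [x >= 0]. *)
    have [[-> z0]|] := sum_binary (fun i => z i 0) z01; last by right.
    by left; split=> // i; have := xz1 i; rewrite z0 subr0 mulr1.
  apply: psd_bordered_01; first exact: psd_dominates_opp.
  have [|[-> z0]|] := sum_binary (fun i => 1 - z i 0); last by right.
    by move=> i; case: (z01 i) => ->; [right; rewrite subr0|left; rewrite subrr].
  left; split=> // i; have := xz i; rewrite mxE oppr_le0.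
  by have /eqP := z0 i; rewrite subr_eq0 => /eqP <-; rewrite mulr1.
move=> X_dom; split=> [[g [h [xgh gP hP]]]|[cop1 cop2]].
  split; first by apply: psd_copositive_bordered gP => i; case/andP: (xgh i).
  rewrite -[x]opprK; apply: (@psd_copositive_bordered _ _ _ _ _ (- h)).
    by move=> i; rewrite !mxE lerN2; case/andP: (xgh i).
  by rewrite opprK.
apply: sysP_of_bounds; apply: copositive_psd_bordered => //.
  exact: psd_dominates_opp.
by rewrite opprK.
Qed.
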